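(* Let $0\le\rho<\pi$ and let $s\ge 1$ be an integer. Suppose that $\psi\in C^{s+1}(\mathbb{R})$ is real-valued and that $w_{\rho,\pi}\in C_c^{s+1}(\mathbb{R})$ is a $C^{s+1}$-bump on $(-\pi,\pi)$. Assume that there exist two constants $M_\psi, M_{\psi_{s+1}}\ge 0$ such that $$|\psi(x)|\le M_\psi\quad\text{and}\quad |\psi^{(s+1)}(x)|\le M_{\psi_{s+1}}\quad\text{for all } x\in(-\pi,\pi).$$ Let $L_s$ denote the Lipschitz constant over $[-\pi,\pi]$ of the $s$-th derivative $\psi_w^{(s)}$ of the $2\pi$-periodic windowed periodization $\psi_w$. Then $$L_s\le M_{\psi_{s+1}}+M_\psi\,\|w^{(s+1)}_{\rho,\pi}\|_\infty+\frac{C_{s,\psi}\,C_{s,w}}{(2\pi)^{s+1}}\cdot K_s,$$ where $$C_{s,\psi}=M_\psi+\frac{(2\pi)^{s+1}}{(s+1)!}M_{\psi_{s+1}},\qquad C_{s,w}=1+\frac{(2\pi)^{s+1}}{(s+1)!}\|w^{(s+1)}_{\rho,\pi}\|_\infty,$$ and $$K_s=\frac{2^{2s+1}\cdot s^2\cdot(3s)!}{(2s+1)!}.$$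
   Context: A $C^{s+1}$-bump on $(-\pi,\pi)$ with parameter $0\le\rho<\pi$ is a function $w_{\rho,\pi}\in C_c^{s+1}(\mathbb{R})$, real-valued, such that (1) $0\le w_{\rho,\pi}(x)\le 1$ for $x\in(-\pi,\pi)$; (2) $w_{\rho,\pi}(x)=0$ for $x\in\mathbb{R}\setminus(-\pi,\pi)$; (3) $w_{\rho,\pi}(x)=1$ for $x\in[-\rho,\rho]$. The windowed periodization $\psi_w\colon\mathbb{R}\to\mathbb{R}$ is the $2\pi$-periodic function with $\psi_w(x)=w_{\rho,\pi}(x)\psi(x)$ for $x\in(-\pi,\pi)$ and $\psi_w(\pi)=0$. $\|\cdot\|_\infty$ is the supremum norm on $\mathbb{R}$. The Lipschitz constant of a function is the smallest constant for which the Lipschitz inequality holds. *)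

(* Defs.v *)
From Stdlib Require Import Reals Factorial.
From Coquelicot Require Import Coquelicot.
Open Scope R_scope.

(* [Derive_n] is total, so the existence of every derivative of order at most
   [k] is required explicitly; continuity of those of order below [k] follows. *)
Definition Ck (k : nat) (f : R -> R) : Prop :=
  (forall n x, (n <= k)%nat -> ex_derive_n f n x) /\
  (forall x, continuous (Derive_n f k) x).

Definition compactly_supported (f : R -> R) : Prop :=
  exists A, forall x, A < Rabs x -> f x = 0.

Definition is_bump (k : nat) (rho : R) (w : R -> R) : Prop :=
  Ck k w /\ compactly_supported w /\
  (forall x, - PI < x < PI -> 0 <= w x <= 1) /\
  (forall x, ~ (- PI < x < PI) -> w x = 0) /\
  (forall x, - rho <= x <= rho -> w x = 1).

Definition is_windowed_periodization (w psi psi_w : R -> R) : Prop :=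
  (forall x, psi_w (x + 2 * PI) = psi_w x) /\
  (forall x, - PI < x < PI -> psi_w x = w x * psi x) /\
  psi_w PI = 0.

(* Meaningful for bounded [f] only: [real] sends an infinite supremum to 0. *)
Definition sup_norm (f : R -> R) : R :=
  real (Lub_Rbar (fun y => exists x, y = Rabs (f x))).

Definition lipschitz_on (f : R -> R) (a b L : R) : Prop :=
  forall x y, a <= x <= b -> a <= y <= b ->
    Rabs (f x - f y) <= L * Rabs (x - y).

Definition is_lipschitz_constant (f : R -> R) (a b L : R) : Prop :=
  lipschitz_on f a b L /\ (forall L', lipschitz_on f a b L' -> L <= L').

(* With [M] bounding the function and [N] its derivative of order [s + 1],
   this is C_{s,psi} for (M_psi, M_{psi_{s+1}}) and C_{s,w} for
   (1, ||w^(s+1)||). *)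
Definition C_const (s : nat) (M N : R) : R :=
  M + (2 * PI) ^ (s + 1) / INR (fact (s + 1)) * N.

Definition K_const (s : nat) : R :=
  2 ^ (2 * s + 1) * INR s ^ 2 * INR (fact (3 * s)) / INR (fact (2 * s + 1)).

(* Main.v *)
(* By Leibniz, the (s+1)-st derivative of [w * psi] is bounded by
   [M_{psi,s+1} + M_psi ||w^(s+1)||] plus the mixed terms
   [C(s+1,k) |w^(k)| |psi^(j)|] with [k + j = s + 1] and [k, j >= 1].
   Let [d] be the distance from [x] to the nearer of [-PI], [PI].  All derivatives
   of [w] vanish there, so Taylor's formula from that endpoint gives
   [|w^(k)(x)| <= ||w^(s+1)|| d^j / j!].  On [[x - d, x + d]] the Taylor
   polynomial of [psi] at [x] differs from [psi] by at most
   [M_{psi,s+1} d^(s+1) / (s+1)!], hence is bounded by [C_{s,psi}]; Lagrange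
   interpolation at the nodes [x + d (2 m / s - 1)], [0 <= m <= s], recovers its
   coefficients and gives
   [d^j / j! |psi^(j)(x)| <= C_{s,psi} (2 s)^s / s!].
   The powers of [d] cancel, so the mixed terms sum to at most
   [C_{s,psi} ||w^(s+1)|| (2^(s+1) - 2) (2 s)^s / s!], which the term with [K_s]
   dominates.  The periodization [psi_w] inherits this bound across the seam,
   since [psi_w x = (w psi)(x) + (w psi)(x - 2 PI)] on [(-PI, 3 PI)] with both
   summands globally smooth. *)
Require Import Defs.
From Stdlib Require Import Reals Factorial Lra Lia.
From Coquelicot Require Import Coquelicot.
From mathcomp Require all_boot all_order all_algebra Rstruct.
Open Scope R_scope.


(** * Coefficients of the Lagrange basis polynomials at equispaced nodes *)

Module LagrangeWeights.
Import all_boot all_order all_algebra Rstruct.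
Import Order.TTheory GRing.Theory Num.Theory.
Local Open Scope ring_scope.

(** Multiplying by ['X - (x i)%:P] shifts the coefficients and subtracts [x i] times them, so each
    factor enlarges a bound common to all coefficients by at most [1 + |x i|]. *)
Lemma norm_coef_prod_XsubC (F : realFieldType) (n j : nat) (P : pred 'I_n)
    (x : nat -> F) :
  `|(\prod_(i < n | P i) ('X - (x i)%:P))`_j| <= \prod_(i < n | P i) (1 + `|x i|).
Proof.
elim/big_rec2: _ j => [|i b p _ IH] j.
  by rewrite coef1; case: (j == 0)%N; rewrite ?normr1 ?normr0 ?ler01.
rewrite mulrBl coefB coefXM coefCM mulrDl mul1r.
apply: le_trans (ler_normB _ _) _; apply: lerD.
  case: (j == 0)%N => //; rewrite normr0.
  exact: le_trans (normr_ge0 _) (IH 0%N).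
by rewrite normrM ler_wpM2l.
Qed.

(** The factors with [i < m] multiply to [m!] (this is [below]); the induction on [n] then appends
    the factors with [i > m], which multiply to [(n - m)!]. *)
Lemma prod_dist_ord (F : realFieldType) (n m : nat) : (m <= n)%N ->
  \prod_(i < n.+1 | i != m :> nat) `|m%:R - i%:R| = (m`! * (n - m)`!)%:R :> F.
Proof.
have below k : \prod_(i < k) `|k%:R - i%:R| = (k`!)%:R :> F.
  elim: k => [|k IH]; first by rewrite big_ord0.
  rewrite big_ord_recl factS natrM subr0 normr_nat; congr (_ * _).
  rewrite -IH; apply: eq_bigr => i _.
  by rewrite lift0 -!natr1 opprD addrACA subrr addr0.
elim: n m => [|n IH] m le_mn.
  by move: le_mn; rewrite leqn0 => /eqP ->; rewrite big_mkcond big_ord1 eqxx.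
rewrite big_mkcond big_ord_recr -big_mkcond /=.
move: le_mn; rewrite leq_eqVlt => /predU1P[-> | lt_mn].
  rewrite eqxx mulr1 subnn muln1 -below; apply: eq_bigl => i.
  by rewrite neq_ltn ltn_ord.
rewrite IH // (gtn_eqF lt_mn) /= subSn // factS distrC -natrB 1?ltnW //.
by rewrite normr_nat subSn // -natrM mulnAC -mulnA.
Qed.

(** Interpolation at [n + 1] distinct nodes reproduces ['X^i] exactly; the identity compares the
    coefficients of degree [j] on both sides. *)
Lemma lagrange_coef_sum (F : realFieldType) (n : nat) (x : nat -> F)
    (i : nat) (j : 'I_n.+1) : injective x -> (i <= n)%N ->
  \sum_(m < n.+1) (tnth (qpoly.lagrange n.+1 x) m : {poly F})`_j * x m ^+ i = (i == j)%:R.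
Proof.
move=> x_inj le_in.
have size_Xi : (size ('X^i : {poly F}) <= n.+1)%N by rewrite size_polyXn.
have /(congr1 (fun p : {poly F} => p`_j)) := qpoly.lagrange_gen (ltn0Sn n) x_inj size_Xi.
rewrite coefXn coef_sum eq_sym => ->; apply: eq_bigr => m _.
by rewrite coefCM hornerXn mulrC.
Qed.

Definition node (F : realFieldType) (n m : nat) : F := 2 * m%:R / n%:R - 1.

Lemma node_sub (F : realFieldType) (n m i : nat) :
  node F n m - node F n i = 2 / n%:R * (m%:R - i%:R).
Proof. by rewrite /node opprB addrA subrK -mulrBl -mulrBr mulrAC. Qed.

Lemma node_inj (F : realFieldType) (n : nat) : (0 < n)%N -> injective (node F n).
Proof.
move=> n_gt0 m i /eqP; rewrite -subr_eq0 node_sub mulf_eq0 subr_eq0 eqr_nat.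
by rewrite mulf_eq0 invr_eq0 !pnatr_eq0 (gtn_eqF n_gt0) /= => /eqP.
Qed.

Lemma norm_node_le1 (F : realFieldType) (n m : nat) : (0 < n)%N -> (m <= n)%N ->
  `|node F n m| <= 1.
Proof.
move=> n_gt0 le_mn; have n_pos : 0 < n%:R :> F by rewrite ltr0n.
rewrite ler_norml /node -subr_ge0 opprK subrK lerBlDr ler_pdivrMr //.
rewrite divr_ge0 ?mulr_ge0 ?ler0n //= -[1 + 1]/(2%:R) -!natrM ler_nat.
by rewrite leq_pmul2l.
Qed.

(** The denominator of the basis polynomial is [(2 / n)^n m! (n - m)!] in absolute value, since
    nodes differ by multiples of [2 / n]. The coefficients of the numerator are at most [2^n], since
    all nodes lie in [[-1, 1]]. The powers of 2 cancel. *)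
Lemma lagrange_node_coef_le (F : realFieldType) (n : nat) (m : 'I_n.+1) (j : nat) :
  (0 < n)%N ->
  `|(tnth (qpoly.lagrange n.+1 (node F n)) m : {poly F})`_j|
    <= n%:R ^+ n / (n`!)%:R * ('C(n, m))%:R.
Proof.
move=> n_gt0; have le_mn : (m <= n)%N by rewrite -ltnS.
have n_neq0 : n%:R != 0 :> F by rewrite pnatr_eq0 -lt0n.
rewrite (qpoly.lagrangeE (ltn0Sn n) (node_inj F n n_gt0)) coefCM normrM.
have cardm : #|[pred i : 'I_n.+1 | i != m :> nat]| = n.
  by rewrite (eq_card (B := predC1 m)) ?cardC1 ?card_ord.
have denom : `|(\prod_(i < n.+1 | i != m :> nat)
    ('X - (node F n i)%:P)).[node F n m]^-1|
    = (n%:R / 2) ^+ n / (m`! * (n - m)`!)%:R.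
  rewrite normfV horner_prod normr_prod -(prod_dist_ord F n m le_mn).
  under eq_bigr => i _ do
    rewrite hornerXsubC node_sub normrM (ger0_norm (divr_ge0 _ _)) ?ler0n //.
  by rewrite big_split /= prodr_const cardm invfM -exprVn invf_div.
rewrite denom; apply: le_trans (ler_wpM2l _ (norm_coef_prod_XsubC F _ _ _ _)) _.
  by rewrite !mulr_ge0 ?invr_ge0 ?exprn_ge0 ?divr_ge0 ?ler0n.
have numer : \prod_(i < n.+1 | i != m :> nat) (1 + `|node F n i|) <= 2 ^+ n.
  rewrite -[n in 2 ^+ n]cardm -prodr_const; apply: ler_prod => i _.
  rewrite addr_ge0 ?ler01 //= -[2]/(1 + 1) lerD2l norm_node_le1 //.
  by rewrite -ltnS.
apply: le_trans (ler_wpM2l _ numer) _.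
  by rewrite !mulr_ge0 ?invr_ge0 ?exprn_ge0 ?divr_ge0 ?ler0n.
rewrite mulrAC -exprMn divfK ?pnatr_eq0 // -mulrA ler_wpM2l ?exprn_ge0 ?ler0n //.
rewrite -(bin_fact le_mn) !natrM !invfM le_eqVlt; apply/orP; left; apply/eqP.
have bin_neq0 : ('C(n, m))%:R != 0 :> F by rewrite pnatr_eq0 -lt0n bin_gt0.
by rewrite [RHS]mulrC mulVKf.
Qed.

#[local] Delimit Scope R_scope with Re.

(** Weighting node values by the degree-[j] coefficients of the basis polynomials reads off
    coefficient [j] of any polynomial of degree at most [s]. In the bound on the weights, the
    binomials [C(s, m)] add up to [2^s]. *)
Lemma interpolation_weights (s j : nat) :
  (1 <= s)%coq_nat -> (j <= s)%coq_nat ->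
  exists a : nat -> R,
    (forall i, (i <= s)%coq_nat ->
      (sum_f_R0 (fun m => a m * (2 * INR m / INR s - 1) ^ i) s
      = if Nat.eqb i j then 1 else 0)%Re) /\
    (sum_f_R0 (fun m => Rabs (a m)) s <= (2 * INR s) ^ s / INR (fact s))%Re.
Proof.
move=> /ssrnat.leP s_gt0 /ssrnat.leP le_js.
have lt_js : (j < s.+1)%N by rewrite ltnS.
(* The basis is indexed by ordinals below [s + 1]; the default 0 for [m > s] never enters the
   sums. *)
exists (fun m => if insub m is Some m' then
  (tnth (qpoly.lagrange s.+1 (node R s)) (m' : 'I_s.+1) : {poly R})`_j else 0).
split=> [i /ssrnat.leP le_is|].
  rewrite sum_f_R0E big_mkord.
  have := lagrange_coef_sum R s (node R s) i (Ordinal lt_js)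
    (node_inj R s s_gt0) le_is.
  rewrite /= => sumE; rewrite (_ : (if _ then _ else _) = (i == j)%:R); last first.
    by case: (Nat.eqb_spec i j) => [->|/eqP/negPf ->] //; rewrite eqxx.
  rewrite -sumE; apply: eq_bigr => m _.
  by rewrite valK RpowE !INRE.
rewrite sum_f_R0E big_mkord factE RpowE !INRE; apply/RleP.
apply: (@le_trans _ _ (\sum_(m < s.+1) s%:R ^+ s / (s`!)%:R * ('C(s, m))%:R)).
  by apply: ler_sum => m _; rewrite valK RabsE lagrange_node_coef_le.
rewrite -mulr_sumr -natr_sum.
have -> : (\sum_(m < s.+1) 'C(s, m) = 2 ^ s)%N.
  rewrite -[2%N]/(1 + 1)%N expnDn; apply: eq_bigr => m _.
  by rewrite !exp1n !muln1.
by rewrite natrX exprMn mulrC mulrA.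
Qed.
End LagrangeWeights.

(** * Finite sums and the Leibniz rule *)

Lemma sum_f_R0_delta (c : nat -> R) (n j : nat) : (j <= n)%nat ->
  sum_f_R0 (fun i => c i * (if Nat.eqb i j then 1 else 0)) n = c j.
Proof.
  assert (below : forall k, (k < j)%nat ->
    sum_f_R0 (fun i => c i * (if Nat.eqb i j then 1 else 0)) k = 0).
  { intros k hk. apply sum_eq_R0; cbv beta; intros i hi.
    destruct (Nat.eqb_spec i j); [lia | ring]. }
  induction n as [|n IH]; intros hj.
  - replace j with O by lia. simpl. ring.
  - rewrite tech5. destruct (Nat.eqb_spec (S n) j) as [<-|ne].
    + rewrite below by lia. ring.
    + rewrite IH by lia. ring.
Qed.

Lemma sum_f_R0_switch (u : nat -> nat -> R) (m n : nat) :
  sum_f_R0 (fun i => sum_f_R0 (u i) n) m =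
  sum_f_R0 (fun j => sum_f_R0 (fun i => u i j) m) n.
Proof.
  transitivity (sum_n (fun i => sum_n (u i) n) m).
  - rewrite sum_n_Reals. apply sum_eq; intros; symmetry; apply sum_n_Reals.
  - rewrite sum_n_switch, sum_n_Reals. apply sum_eq; intros; apply sum_n_Reals.
Qed.

(** The combinatorial half of the induction step in the Leibniz rule: differentiating one product
    yields [T (S i) + T i], and Pascal's rule merges the two resulting sums. *)
Lemma sum_pascal (T : nat -> R) (k : nat) :
  sum_f_R0 (fun i => Binomial.C k i * (T (S i) + T i)) k =
  sum_f_R0 (fun i => Binomial.C (S k) i * T i) (S k).
Proof.
  destruct k as [|p].
  - simpl. rewrite !C_n_0, C_n_n. ring.
  - rewrite (decomp_sum (fun i => Binomial.C (S (S p)) i * T i)) by lia.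
    simpl pred. rewrite (tech5 (fun i => Binomial.C (S (S p)) (S i) * T (S i))).
    rewrite (sum_eq (fun i => Binomial.C (S (S p)) (S i) * T (S i))
      (fun i => Binomial.C (S p) i * T (S i) + Binomial.C (S p) (S i) * T (S i))) by
      (intros i hi; rewrite <- (pascal (S p) i) by lia; ring).
    rewrite (sum_eq (fun i => Binomial.C (S p) i * (T (S i) + T i))
      (fun i => Binomial.C (S p) i * T (S i) + Binomial.C (S p) i * T i)) by
      (intros; ring).
    rewrite !sum_plus.
    rewrite (tech5 (fun i => Binomial.C (S p) i * T (S i))).
    rewrite (decomp_sum (fun i => Binomial.C (S p) i * T i)) by lia.
    simpl pred. rewrite !C_n_n, !C_n_0. ring.
Qed.

Lemma is_derive_sum_f_R0 (F : nat -> R -> R) (dF : nat -> R) (k : nat) (x : R) :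
  (forall i, (i <= k)%nat -> is_derive (F i) x (dF i)) ->
  is_derive (fun y => sum_f_R0 (fun i => F i y) k) x (sum_f_R0 dF k).
Proof.
  induction k as [|k IH]; intros H; simpl.
  - apply H; lia.
  - apply (is_derive_plus (fun y => sum_f_R0 (fun i => F i y) k) (F (S k))).
    + apply IH; intros; apply H; lia.
    + apply H; lia.
Qed.

Lemma is_derive_Derive_n (f : R -> R) (n : nat) (x : R) :
  ex_derive_n f (S n) x -> is_derive (Derive_n f n) x (Derive_n f (S n) x).
Proof. exact (Derive_correct (Derive_n f n) x). Qed.

Lemma is_derive_n_mult (f g : R -> R) (n : nat) :
  (forall k x, (k <= n)%nat -> ex_derive_n f k x) ->
  (forall k x, (k <= n)%nat -> ex_derive_n g k x) ->
  forall x, is_derive_n (fun y => f y * g y) n x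
    (sum_f_R0 (fun i => Binomial.C n i * (Derive_n f i x * Derive_n g (n - i) x)) n).
Proof.
  induction n as [|n IH]; intros Hf Hg x.
  - simpl. rewrite C_n_n. ring.
  - assert (IH' : forall y, sum_f_R0 (fun i =>
        Binomial.C n i * (Derive_n f i y * Derive_n g (n - i) y)) n
        = Derive_n (fun y => f y * g y) n y).
    { intros y. symmetry. apply is_derive_n_unique, IH;
        intros; [apply Hf | apply Hg]; lia. }
    apply (is_derive_ext _ _ _ _ IH').
    (* Pascal's rule is undone, so that each summand is the derivative of a single product of order
       [i] in [f] and [n - i] in [g]. *)
    rewrite <- (sum_pascal (fun i => Derive_n f i x * Derive_n g (S n - i) x)).
    apply is_derive_sum_f_R0; intros i hi.
    apply (is_derive_scal (fun y => Derive_n f i y * Derive_n g (n - i) y)).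
    replace (S n - S i)%nat with (n - i)%nat by lia.
    replace (S n - i)%nat with (S (n - i)) by lia.
    apply (is_derive_mult (Derive_n f i) (Derive_n g (n - i))).
    + apply is_derive_Derive_n, Hf; lia.
    + apply is_derive_Derive_n, Hg; lia.
    + intros; apply Rmult_comm.
Qed.

(** * Taylor remainders and bounds on intermediate derivatives *)

Lemma taylor_remainder_bound (f : R -> R) (n : nat) (x y N : R) :
  (forall k t, (k <= S n)%nat -> ex_derive_n f k t) ->
  0 <= N ->
  (forall t, Rmin x y < t < Rmax x y -> Rabs (Derive_n f (S n) t) <= N) ->
  Rabs (f y - sum_f_R0 (fun i => (y - x) ^ i / INR (fact i) * Derive_n f i x) n)
    <= Rabs (y - x) ^ S n / INR (fact (S n)) * N.
Proof.
  assert (forward : forall g a b, a < b ->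
    (forall k t, (k <= S n)%nat -> ex_derive_n g k t) ->
    (forall t, a < t < b -> Rabs (Derive_n g (S n) t) <= N) ->
    Rabs (g b - sum_f_R0 (fun i => (b - a) ^ i / INR (fact i) * Derive_n g i a) n)
      <= Rabs (b - a) ^ S n / INR (fact (S n)) * N).
  { intros g a b ab Hg HN.
    destruct (Taylor_Lagrange g n a b ab) as (z & hz & ->).
    { intros; apply Hg; assumption. }
    unfold Rminus at 1. rewrite Rplus_comm, <- Rplus_assoc, Rplus_opp_l, Rplus_0_l.
    unfold Rdiv. rewrite !Rabs_mult, <- RPow_abs, (Rabs_pos_eq (/ _)).
    - apply Rmult_le_compat_l; [|apply HN, hz].
      apply Rmult_le_pos; [apply pow_le, Rabs_pos|].
      left; apply Rinv_0_lt_compat, INR_fact_lt_0.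
    - left; apply Rinv_0_lt_compat, INR_fact_lt_0. }
  intros Hf N0 HN.
  destruct (Rtotal_order x y) as [xy | [<- | yx]].
  - apply forward; auto. intros t ht. apply HN.
    rewrite Rmin_left, Rmax_right; lra.
  - rewrite Rminus_diag. replace (sum_f_R0 _ n) with (f x).
    + rewrite Rminus_diag, Rabs_R0. simpl pow. rewrite Rmult_0_l.
      unfold Rdiv. rewrite !Rmult_0_l. lra.
    + symmetry. clear. induction n as [|n IH]; simpl sum_f_R0.
      * simpl. field.
      * rewrite IH. simpl pow. unfold Rdiv. rewrite !Rmult_0_l. ring.
  (* For [y < x] the function is reflected so that [forward] applies; the sign [(-1)^i] of its
     derivatives cancels the one in [(- y - - x)^i]. *)
  - assert (opp : forall k t, (k <= S n)%nat ->
      Derive_n (fun u => f (- u)) k t = (-1) ^ k * Derive_n f k (- t)).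
    { intros k t hk. apply Derive_n_comp_opp.
      apply filter_forall; intros; apply Hf; lia. }
    pose proof (forward (fun u => f (- u)) (- x) (- y)) as B.
    cbv beta in B. rewrite Ropp_involutive in B.
    replace (Rabs (- y - - x)) with (Rabs (y - x)) in B
      by (rewrite <- Rabs_Ropp; f_equal; ring).
    erewrite (sum_eq (fun i => (- y - - x) ^ i / _ * _)) in B.
    + apply B; [lra | |].
      * intros; apply ex_derive_n_comp_opp.
        apply filter_forall; intros; apply Hf; lia.
      * intros t ht. rewrite opp, Rabs_mult, pow_1_abs, Rmult_1_l by lia.
        apply HN. rewrite Rmin_right, Rmax_left; lra.
    + intros i hi. rewrite opp, Ropp_involutive by lia.
      replace (- y - - x) with (-1 * (y - x)) by ring.
      rewrite Rpow_mult_distr.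
      replace ((-1) ^ i * (y - x) ^ i / INR (fact i) * ((-1) ^ i * Derive_n f i x))
        with (((-1) * (-1)) ^ i * ((y - x) ^ i / INR (fact i) * Derive_n f i x)).
      * replace (-1 * -1) with 1 by ring. rewrite pow1. apply Rmult_1_l.
      * rewrite Rpow_mult_distr. unfold Rdiv. ring.
Qed.

Lemma Rabs_le_closure (f : R -> R) (x M : R) : continuous f x ->
  (forall eps, 0 < eps -> exists y, Rabs (y - x) < eps /\ Rabs (f y) <= M) ->
  Rabs (f x) <= M.
Proof.
  intros Hc H. apply Rnot_lt_le; intros HM.
  assert (Hp : 0 < Rabs (f x) - M) by lra.
  destruct (proj1 (filterlim_locally f (f x)) Hc (mkposreal _ Hp)) as [e He].
  destruct (H e (cond_pos e)) as (y & hy & fy).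
  specialize (He y hy). change (Rabs (f y - f x) < Rabs (f x) - M) in He.
  pose proof (Rabs_triang_inv (f x) (f y)). rewrite (Rabs_minus_sym (f x)) in H0. lra.
Qed.

Lemma intermediate_derivative_bound (f : R -> R) (s j : nat) (x d M N : R) :
  (1 <= s)%nat -> (j <= s)%nat -> 0 < d -> 0 <= N ->
  (forall k t, (k <= s + 1)%nat -> ex_derive_n f k t) ->
  (forall t, x - d <= t <= x + d -> Rabs (f t) <= M) ->
  (forall t, x - d < t < x + d -> Rabs (Derive_n f (s + 1) t) <= N) ->
  d ^ j / INR (fact j) * Rabs (Derive_n f j x) <=
    (M + d ^ (s + 1) / INR (fact (s + 1)) * N) * ((2 * INR s) ^ s / INR (fact s)).
Proof.
  rewrite Nat.add_1_r. intros hs hj hd hN Hf HM HN.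
  destruct (LagrangeWeights.interpolation_weights s j hs hj) as (a & Ha & Hsum).
  assert (s_pos : 0 < INR s) by (apply lt_0_INR; lia).
  set (node m := 2 * INR m / INR s - 1) in Ha.
  set (B := M + d ^ S s / INR (fact (S s)) * N).
  set (P y := sum_f_R0 (fun i => (y - x) ^ i / INR (fact i) * Derive_n f i x) s).
  assert (node_bound : forall m, (m <= s)%nat -> Rabs (node m) <= 1).
  { intros m hm. apply Rabs_le. unfold node.
    assert (0 <= INR m / INR s <= 1).
    { split.
      - apply Rle_div_r; [lra|]. rewrite Rmult_0_l. apply pos_INR.
      - apply Rle_div_l; [lra|]. rewrite Rmult_1_l. apply le_INR, hm. }
    unfold Rdiv in *. lra. }
  (* Every node lies within [d] of [x], so there [|P| <= |f| + |f - P|] is controlled by [M] and the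
     Taylor remainder. *)
  assert (P_bound : forall m, (m <= s)%nat -> Rabs (P (x + d * node m)) <= B).
  { intros m hm. specialize (node_bound m hm).
    assert (dn : Rabs (d * node m) <= d).
    { rewrite Rabs_mult, (Rabs_pos_eq d) by lra. nra. }
    pose proof dn as dn'. apply Rabs_le_between in dn'.
    assert (T : Rabs (f (x + d * node m) - P (x + d * node m))
      <= d ^ S s / INR (fact (S s)) * N).
    { eapply Rle_trans.
      - apply (taylor_remainder_bound f s x (x + d * node m) N); [exact Hf | exact hN |].
        intros t ht. apply HN.
        destruct ht as [h1 h2]. split.
        + apply Rle_lt_trans with (2 := h1). apply Rmin_glb; lra.
        + apply Rlt_le_trans with (1 := h2). apply Rmax_lub; lra.
      - apply Rmult_le_compat_r; [exact hN|].
        apply Rmult_le_compat_r; [left; apply Rinv_0_lt_compat, INR_fact_lt_0|].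
        apply pow_incr. replace (x + d * node m - x) with (d * node m) by ring.
        split; [apply Rabs_pos | exact dn]. }
    assert (F : Rabs (f (x + d * node m)) <= M) by (apply HM; lra).
    unfold B. pose proof (Rabs_triang_inv (P (x + d * node m)) (f (x + d * node m))).
    rewrite Rabs_minus_sym in H. lra. }
  (* In the variable [u = (y - x) / d] the polynomial [P] has coefficients [c i], so the weights
     recover [c j] from its values at the nodes. *)
  assert (extract : d ^ j / INR (fact j) * Derive_n f j x
    = sum_f_R0 (fun m => a m * P (x + d * node m)) s).
  { set (c i := d ^ i / INR (fact i) * Derive_n f i x).
    transitivity (sum_f_R0 (fun i => c i * (if Nat.eqb i j then 1 else 0)) s).
    - symmetry. apply (sum_f_R0_delta c s j hj).
    - rewrite (sum_eq _ (fun i => sum_f_R0 (fun m => c i * (a m * node m ^ i)) s)).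
      + rewrite sum_f_R0_switch. apply sum_eq; intros m _.
        unfold P. rewrite scal_sum. apply sum_eq; intros i _.
        replace (x + d * node m - x) with (d * node m) by ring.
        rewrite Rpow_mult_distr. unfold c, Rdiv. ring.
      + intros i hi. rewrite <- Ha, scal_sum by exact hi.
        apply sum_eq; intros; unfold node; ring. }
  replace (d ^ j / INR (fact j) * Rabs (Derive_n f j x))
    with (Rabs (d ^ j / INR (fact j) * Derive_n f j x)).
  2:{ rewrite Rabs_mult, (Rabs_pos_eq (d ^ j / _)); [reflexivity|].
      apply Rmult_le_pos; [apply pow_le; lra|].
      left; apply Rinv_0_lt_compat, INR_fact_lt_0. }
  rewrite extract.
  (* The sign of [M] is not assumed; [B] is nonnegative because it bounds an absolute value at node
     0. *)
  assert (B0 : 0 <= B) by (eapply Rle_trans; [apply Rabs_pos | apply (P_bound O); lia]).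
  eapply Rle_trans; [apply Rsum_abs|].
  eapply Rle_trans; [|apply Rmult_le_compat_l; [exact B0 | exact Hsum]].
  rewrite scal_sum. apply sum_Rle; intros m hm.
  rewrite Rabs_mult. apply Rmult_le_compat_l; [apply Rabs_pos | apply P_bound, hm].
Qed.

(** * Comparison with the constant [K_s] *)

Lemma fact_ratio_lower (m k : nat) : (fact m * m ^ k <= fact (m + k))%nat.
Proof.
  induction k as [|k IH]; [rewrite Nat.add_0_r; simpl; lia|].
  rewrite Nat.add_succ_r. simpl fact. simpl Nat.pow. nia.
Qed.

(** Since [(s + 1)! / s! = s + 1], the left side is [2 (2^s - 1) (s + 1) (2 s)] times
    [(2 s)^(s - 1)]. The last power is at most [(3 s)! / (2 s + 1)!], a product of [s - 1] factors
    above [2 s + 1]; the rest is at most [2^(2 s + 1) s^2]. *)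
Lemma K_const_lower (s : nat) : (1 <= s)%nat ->
  (2 ^ (s + 1) - 2) * INR (fact (s + 1)) * ((2 * INR s) ^ s / INR (fact s))
    <= K_const s.
Proof.
  intros hs. destruct s as [|p]; [lia|]. set (s := S p).
  assert (hS : 1 <= INR s) by (apply (le_INR 1); unfold s; lia).
  assert (fact_ratio : (2 * INR s) ^ p
    <= INR (fact (3 * s)) / INR (fact (2 * s + 1))).
  { apply Rle_div_r; [apply Rlt_gt, INR_fact_lt_0|].
    replace (2 * INR s) with (INR (2 * s)) by (rewrite mult_INR; reflexivity).
    rewrite <- pow_INR, <- mult_INR. apply le_INR.
    replace (3 * s)%nat with ((2 * s + 1) + p)%nat by (unfold s; lia).
    eapply Nat.le_trans; [|apply fact_ratio_lower].
    rewrite Nat.mul_comm. apply Nat.mul_le_mono_l, Nat.pow_le_mono_l; lia. }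
  assert (pow_lower : INR s + 1 <= 2 ^ s).
  { clear. induction s as [|s IH]; [simpl; lra|].
    rewrite S_INR. simpl pow. pose proof (pos_INR s). lra. }
  unfold K_const.
  replace ((2 ^ (s + 1) - 2) * INR (fact (s + 1)) * ((2 * INR s) ^ s / INR (fact s)))
    with ((2 * (2 ^ s - 1) * (INR s + 1) * (2 * INR s)) * (2 * INR s) ^ p).
  2:{ rewrite Nat.add_1_r. change (fact (S s)) with (S s * fact s)%nat.
      change (2 ^ S s) with (2 * 2 ^ s).
      change ((2 * INR s) ^ s) with (2 * INR s * (2 * INR s) ^ p).
      rewrite mult_INR, (S_INR s). field. apply INR_fact_neq_0. }
  unfold Rdiv. rewrite (Rmult_assoc (_ * INR s ^ 2)).
  apply Rmult_le_compat; [| apply pow_le; lra | | exact fact_ratio].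
  - repeat apply Rmult_le_pos; lra.
  - rewrite pow_add, Nat.mul_comm, pow_mult, pow_1. set (u := 2 ^ s) in *.
    replace (u ^ 2 * 2 * INR s ^ 2) with (u ^ 2 * INR s * (2 * INR s)) by ring.
    apply Rmult_le_compat_r; [lra|].
    clearbody u. set (r := INR s) in *. clearbody r.
    (* First [r + 1 <= 2 r], then [4 (u - 1) <= u^2], which is [(u - 2)^2 >= 0]. *)
    apply Rle_trans with (4 * (u - 1) * r).
    + pose proof (Rmult_le_pos (u - 1) (r - 1)). lra.
    + pose proof (Rmult_le_pos ((u - 2) ^ 2) r (pow2_ge_0 _)). lra.
Qed.

(** * Supremum norms and functions vanishing outside an interval *)

Lemma Rabs_le_sup_norm (f : R -> R) (B x : R) :
  (forall y, Rabs (f y) <= B) -> Rabs (f x) <= sup_norm f.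
Proof.
  intros HB. unfold sup_norm.
  set (E := fun y => exists x, y = Rabs (f x)).
  destruct (Lub_Rbar_correct E) as [ub lub].
  assert (Hx := ub (Rabs (f x)) (ex_intro _ x eq_refl)).
  (* Together with [Hx] this makes the supremum finite, so [real] does not fall back to 0. *)
  assert (HL : Rbar_le (Lub_Rbar E) B).
  { apply lub. intros y [z ->]. apply HB. }
  destruct (Lub_Rbar E); simpl in *; tauto.
Qed.

Lemma bounded_of_zero_outside (f : R -> R) (a b : R) : a <= b ->
  (forall x, continuous f x) -> (forall x, ~ (a < x < b) -> f x = 0) ->
  exists B, forall x, Rabs (f x) <= B.
Proof.
  intros ab Hc Hz.
  destruct (continuity_ab_maj (fun x => Rabs (f x)) a b ab) as (c & Hmax & _).
  { intros c _. apply continuity_pt_filterlim.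
    apply (continuous_comp f Rabs); [apply Hc | apply continuous_Rabs]. }
  exists (Rabs (f c)). intros x.
  destruct (Rlt_dec a x); [destruct (Rlt_dec x b)|].
  - apply Hmax; lra.
  - rewrite Hz, Rabs_R0 by lra. apply Rabs_pos.
  - rewrite Hz, Rabs_R0 by lra. apply Rabs_pos.
Qed.

Lemma Derive_n_zero (n : nat) (x : R) : Derive_n (fun _ => 0) n x = 0.
Proof. destruct n; [reflexivity | apply Derive_n_const]. Qed.

(** Strictly outside [[a, b]] the function vanishes on a neighbourhood; continuity of the derivative
    carries the value 0 to the endpoints. *)
Lemma Derive_n_zero_outside (f : R -> R) (a b x : R) (k : nat) :
  (forall t, ~ (a < t < b) -> f t = 0) -> continuous (Derive_n f k) x ->
  ~ (a < x < b) -> Derive_n f k x = 0.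
Proof.
  intros Hz Hc Hx.
  assert (away : forall y, (y < a \/ b < y) -> Derive_n f k y = 0).
  { intros y hy. rewrite <- (Derive_n_zero k y). apply Derive_n_ext_loc.
    destruct hy as [hy|hy].
    - apply (locally_interval _ y m_infty a); simpl; auto.
      intros t _ ht. apply Hz; lra.
    - apply (locally_interval _ y b p_infty); simpl; auto.
      intros t ht _. apply Hz; lra. }
  apply Rabs_eq_0, Rle_antisym; [|apply Rabs_pos].
  apply (Rabs_le_closure _ x); [exact Hc|]. intros eps heps.
  destruct (Rle_dec x a).
  - exists (x - eps / 2). split.
    + rewrite Rabs_left; lra.
    + rewrite away by lra. rewrite Rabs_R0. lra.
  - exists (x + eps / 2). split.
    + rewrite Rabs_pos_eq; lra.
    + rewrite away by lra. rewrite Rabs_R0. lra.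
Qed.

Lemma ex_derive_n_Derive_n (f : R -> R) (i k : nat) (x : R) :
  ex_derive_n f (i + k) x -> ex_derive_n (Derive_n f k) i x.
Proof.
  destruct i as [|i]; [simpl; trivial|]. simpl. apply ex_derive_ext.
  intros t. symmetry. apply Derive_n_comp.
Qed.

(** In Taylor's formula of degree [j - 1] for [Derive_n f k] at [e], every polynomial term vanishes
    and only the remainder is left. *)
Lemma derivative_bound_from_flat_point (f : R -> R) (k j : nat) (e x W : R) :
  (1 <= j)%nat -> 0 <= W ->
  (forall i t, (i <= k + j)%nat -> ex_derive_n f i t) ->
  (forall i, (i < k + j)%nat -> Derive_n f i e = 0) ->
  (forall t, Rabs (Derive_n f (k + j) t) <= W) ->
  Rabs (Derive_n f k x) <= Rabs (x - e) ^ j / INR (fact j) * W.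
Proof.
  intros hj hW Hf He HW. destruct j as [|j]; [lia|].
  pose proof (taylor_remainder_bound (Derive_n f k) j e x W) as T.
  rewrite (sum_eq_R0 _ j), Rminus_0_r in T.
  - apply T; [| exact hW |].
    + intros i t hi. apply ex_derive_n_Derive_n, Hf. lia.
    + intros t _. rewrite Derive_n_comp, Nat.add_comm. apply HW.
  - cbv beta. intros i hi. rewrite Derive_n_comp, He by lia. ring.
Qed.

Lemma Ck_continuous_Derive_n (n k : nat) (f : R -> R) (x : R) :
  Ck n f -> (k <= n)%nat -> continuous (Derive_n f k) x.
Proof.
  intros [Hd Hc] hk. destruct (Nat.eq_dec k n) as [->|]; [apply Hc|].
  apply (ex_derive_continuous (Derive_n f k)). apply (Hd (S k)). lia.
Qed.

(** Expand [(1 + 1)^(p + 2)] and drop the two end terms, each equal to 1. These are the weights of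
    the mixed Leibniz terms when [s = p + 1]. *)
Lemma sum_inner_binomials (p : nat) :
  sum_f_R0 (fun i => Binomial.C (S (S p)) (S i)) p = 2 ^ S (S p) - 2.
Proof.
  replace 2 with (1 + 1) at 1 by ring. rewrite binomial.
  rewrite tech5, (decomp_sum _ (S p)) by lia. simpl pred.
  rewrite C_n_0, C_n_n, !pow1.
  rewrite (sum_eq (fun i => Binomial.C (S (S p)) (S i) * _ * _)
    (fun i => Binomial.C (S (S p)) (S i))); [simpl; ring|].
  intros i _. rewrite !pow1. ring.
Qed.

Lemma C_pos (n i : nat) : 0 <= Binomial.C n i.
Proof.
  unfold Binomial.C. apply Rle_div_r.
  - apply Rlt_gt, Rmult_lt_0_compat; apply INR_fact_lt_0.
  - rewrite Rmult_0_l. apply pos_INR.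
Qed.

(** * The derivative of order [s + 1] of the windowed product *)

Section Window.

Variables (rho : R) (s : nat) (psi w : R -> R) (M N : R).
Hypotheses (hs : (1 <= s)%nat) (hpsi : Ck (s + 1) psi)
  (hw : is_bump (s + 1) rho w) (hM : 0 <= M) (hN : 0 <= N).
Hypothesis hbound : forall x, - PI < x < PI ->
  Rabs (psi x) <= M /\ Rabs (Derive_n psi (s + 1) x) <= N.

Let W := sup_norm (Derive_n w (s + 1)).

Lemma window_derivative_outside (k : nat) (x : R) :
  (k <= s + 1)%nat -> ~ (- PI < x < PI) -> Derive_n w k x = 0.
Proof.
  destruct hw as (Hk & _ & _ & Hz & _). intros hk hx.
  apply (Derive_n_zero_outside w (- PI) PI); auto.
  apply (Ck_continuous_Derive_n _ _ _ _ Hk hk).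
Qed.

Lemma window_top_derivative_le (x : R) : Rabs (Derive_n w (s + 1) x) <= W.
Proof.
  pose proof PI_RGT_0.
  destruct (bounded_of_zero_outside (Derive_n w (s + 1)) (- PI) PI) as [B HB].
  - lra.
  - apply hw.
  - intros; apply window_derivative_outside; auto.
  - apply (Rabs_le_sup_norm _ B x HB).
Qed.

Lemma W_pos : 0 <= W.
Proof. eapply Rle_trans; [apply Rabs_pos | apply (window_top_derivative_le 0)]. Qed.

Lemma psi_bound_closed (x : R) : - PI <= x <= PI -> Rabs (psi x) <= M.
Proof.
  intros hx. pose proof PI_RGT_0. pose proof PI_4.
  apply Rabs_le_closure.
  - apply (Ck_continuous_Derive_n (s + 1) 0 psi x hpsi). lia.
  (* Scaling by [1 - eta] pulls [x] into the open interval and moves it by at most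
     [eta * PI <= eps / 2], as [PI <= 4]. *)
  - intros eps heps. set (eta := Rmin (1 / 2) (eps / 8)).
    assert (h1 : eta <= 1 / 2) by apply Rmin_l.
    assert (h2 : eta <= eps / 8) by apply Rmin_r.
    assert (h0 : 0 < eta) by (apply Rmin_glb_lt; lra).
    exists ((1 - eta) * x). split.
    + apply Rabs_def1; nra.
    + apply hbound. split; nra.
Qed.

Lemma mixed_term_bound (i : nat) (x : R) : (1 <= i <= s)%nat -> - PI < x < PI ->
  Rabs (Derive_n w i x * Derive_n psi (s + 1 - i) x) <=
    C_const s M N * W * ((2 * INR s) ^ s / INR (fact s)).
Proof.
  intros hi hx. pose proof W_pos as hW. pose proof PI_RGT_0.
  set (j := (s + 1 - i)%nat).
  (* Taking the nearer endpoint keeps [[x - d, x + d]] inside [[-PI, PI]], where [psi] is bounded by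
     [M]. *)
  assert (nearest : exists e d, ~ (- PI < e < PI) /\ Rabs (x - e) = d /\ 0 < d /\
    - PI <= x - d /\ x + d <= PI).
  { destruct (Rle_dec 0 x).
    - exists PI, (PI - x). rewrite Rabs_left by lra. repeat split; lra.
    - exists (- PI), (x + PI). rewrite Rabs_pos_eq by lra. repeat split; lra. }
  destruct nearest as (e & d & he & hd & hd0 & hl & hr).
  assert (w_le : Rabs (Derive_n w i x) <= d ^ j / INR (fact j) * W).
  { rewrite <- hd.
    apply derivative_bound_from_flat_point; [unfold j; lia | exact hW | | |];
      replace (i + j)%nat with (s + 1)%nat by (unfold j; lia).
    - apply hw.
    - intros k hk. apply window_derivative_outside; [lia | exact he].
    - exact window_top_derivative_le. }
  assert (psi_le : d ^ j / INR (fact j) * Rabs (Derive_n psi j x) <=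
    (M + d ^ (s + 1) / INR (fact (s + 1)) * N) * ((2 * INR s) ^ s / INR (fact s))).
  { apply intermediate_derivative_bound; auto; try (unfold j; lia).
    - apply hpsi.
    - intros t ht. apply psi_bound_closed. lra.
    - intros t ht. apply hbound. lra. }
  (* Here [d <= PI], so passing to the [2 * PI] of [C_const] only enlarges the bound. *)
  assert (C_le : M + d ^ (s + 1) / INR (fact (s + 1)) * N <= C_const s M N).
  { unfold C_const. apply Rplus_le_compat_l, Rmult_le_compat_r; [exact hN|].
    apply Rmult_le_compat_r; [left; apply Rinv_0_lt_compat, INR_fact_lt_0|].
    apply pow_incr; lra. }
  assert (Q : 0 <= (2 * INR s) ^ s / INR (fact s)).
  { apply Rmult_le_pos; [apply pow_le; pose proof (pos_INR s); lra|].
    left; apply Rinv_0_lt_compat, INR_fact_lt_0. }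
  rewrite Rabs_mult.
  apply Rle_trans with (d ^ j / INR (fact j) * W * Rabs (Derive_n psi j x)).
  { apply Rmult_le_compat_r; [apply Rabs_pos | exact w_le]. }
  replace (d ^ j / INR (fact j) * W * Rabs (Derive_n psi j x))
    with (W * (d ^ j / INR (fact j) * Rabs (Derive_n psi j x))) by ring.
  rewrite (Rmult_comm _ W), Rmult_assoc.
  apply Rmult_le_compat_l; [exact hW|].
  eapply Rle_trans; [exact psi_le|].
  apply Rmult_le_compat_r; assumption.
Qed.

(** The right-hand side of the claimed estimate. *)
Definition lipschitz_bound : R :=
  N + M * W + C_const s M N * C_const s 1 W / (2 * PI) ^ (s + 1) * K_const s.

Lemma C_const_pos (A B : R) : 0 <= A -> 0 <= B -> 0 <= C_const s A B.
Proof.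
  intros hA hB. unfold C_const. pose proof PI_RGT_0.
  apply Rplus_le_le_0_compat; [exact hA|]. apply Rmult_le_pos; [|exact hB].
  apply Rmult_le_pos; [apply pow_le; lra|].
  left; apply Rinv_0_lt_compat, INR_fact_lt_0.
Qed.

Lemma K_const_pos : 0 <= K_const s.
Proof.
  unfold K_const. apply Rmult_le_pos.
  - apply Rmult_le_pos; [|apply pos_INR].
    apply Rmult_le_pos; [apply pow_le; lra | apply pow2_ge_0].
  - left; apply Rinv_0_lt_compat, INR_fact_lt_0.
Qed.

(** Dropping the summand 1 of [C_const s 1 W] and dividing by [(2 * PI)^(s + 1)] leaves
    [W / (s + 1)!]; the factor [(s + 1)!] is absorbed by [K_const_lower]. *)
Lemma mixed_terms_le :
  (2 ^ (s + 1) - 2) * (C_const s M N * W * ((2 * INR s) ^ s / INR (fact s)))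
    <= C_const s M N * C_const s 1 W / (2 * PI) ^ (s + 1) * K_const s.
Proof.
  pose proof W_pos. pose proof PI_RGT_0. pose proof (INR_fact_lt_0 (s + 1)).
  pose proof (C_const_pos M N hM hN). pose proof K_const_pos as K0.
  assert (P0 : 0 < (2 * PI) ^ (s + 1)) by (apply pow_lt; lra).
  apply Rle_trans with (C_const s M N * W / INR (fact (s + 1)) * K_const s).
  - apply Rle_trans with (C_const s M N * W / INR (fact (s + 1)) *
      ((2 ^ (s + 1) - 2) * INR (fact (s + 1)) * ((2 * INR s) ^ s / INR (fact s)))).
    + right. field. split; apply INR_fact_neq_0.
    + apply Rmult_le_compat_l; [|apply K_const_lower, hs].
      apply Rmult_le_pos; [apply Rmult_le_pos; assumption|].
      left; apply Rinv_0_lt_compat, INR_fact_lt_0.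
  - apply Rmult_le_compat_r; [exact K0|].
    unfold Rdiv. rewrite !Rmult_assoc. apply Rmult_le_compat_l; [assumption|].
    unfold C_const at 1. rewrite Rmult_plus_distr_r.
    apply Rle_trans with
      ((2 * PI) ^ (s + 1) / INR (fact (s + 1)) * W * / (2 * PI) ^ (s + 1)).
    + right. field. split; apply Rgt_not_eq; assumption.
    + pose proof (Rinv_0_lt_compat _ P0). lra.
Qed.

Lemma lipschitz_bound_pos : 0 <= lipschitz_bound.
Proof.
  unfold lipschitz_bound. pose proof W_pos. pose proof PI_RGT_0.
  repeat apply Rplus_le_le_0_compat; [assumption | apply Rmult_le_pos; assumption|].
  apply Rmult_le_pos; [|apply K_const_pos].
  apply Rmult_le_pos; [apply Rmult_le_pos; apply C_const_pos; lra|].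
  left. apply Rinv_0_lt_compat, pow_lt. lra.
Qed.

Lemma windowed_derivative_bound (x : R) :
  Rabs (Derive_n (fun y => w y * psi y) (s + 1) x) <= lipschitz_bound.
Proof.
  rewrite (is_derive_n_unique _ _ _ _
    (is_derive_n_mult w psi (s + 1) (proj1 (proj1 hw)) (proj1 hpsi) x)).
  destruct (Rlt_dec (- PI) x) as [h1|h1]; [destruct (Rlt_dec x PI) as [h2|h2]|].
  (* Outside the open interval all derivatives of [w] up to order [s + 1] vanish, hence every
     Leibniz term does. *)
  2,3: rewrite sum_eq_R0; [rewrite Rabs_R0; apply lipschitz_bound_pos|];
    intros i hi; rewrite window_derivative_outside by (assumption || lra); ring.
  destruct (hbound x (conj h1 h2)) as [psi0 psin].
  destruct hw as (_ & _ & w01 & _). specialize (w01 x (conj h1 h2)).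
  pose proof (window_top_derivative_le x) as wn.
  pose proof mixed_terms_le as mix. pose proof mixed_term_bound as term.
  unfold lipschitz_bound.
  (* With [s = p + 1] the Leibniz sum splits into two end terms, bounded by [N] (as [0 <= w <= 1])
     and [M * W], and [p + 1] mixed terms. *)
  destruct s as [|p]; [lia|]. rewrite Nat.add_1_r in *.
  rewrite tech5, decomp_sum by lia. simpl pred.
  rewrite C_n_0, C_n_n, Nat.sub_diag, Nat.sub_0_r, !Rmult_1_l.
  change (Derive_n w 0 x) with (w x). change (Derive_n psi 0 x) with (psi x).
  eapply Rle_trans; [apply Rabs_triang|].
  eapply Rle_trans; [apply Rplus_le_compat_r, Rabs_triang|].
  assert (T1 : Rabs (w x * Derive_n psi (S (S p)) x) <= N).
  { rewrite Rabs_mult, (Rabs_pos_eq (w x)) by lra.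
    pose proof (Rabs_pos (Derive_n psi (S (S p)) x)). nra. }
  assert (T3 : Rabs (Derive_n w (S (S p)) x * psi x) <= M * W).
  { rewrite Rabs_mult, Rmult_comm. apply Rmult_le_compat; auto using Rabs_pos. }
  enough (T2 : Rabs (sum_f_R0 (fun i => Binomial.C (S (S p)) (S i) *
    (Derive_n w (S i) x * Derive_n psi (S (S p) - S i) x)) p) <=
    (2 ^ S (S p) - 2) *
      (C_const (S p) M N * W * ((2 * INR (S p)) ^ S p / INR (fact (S p)))))
    by lra.
  eapply Rle_trans; [apply Rsum_abs|].
  rewrite <- sum_inner_binomials, Rmult_comm, scal_sum.
  apply sum_Rle; intros i hi. rewrite Rabs_mult, (Rabs_pos_eq _ (C_pos _ _)).
  apply Rmult_le_compat_l; [apply C_pos|].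
  specialize (term (S i) x).
  apply term; [lia | lra].
Qed.

End Window.

(** * Existence of Lipschitz constants, and periodicity *)

Lemma is_derive_n_ex (f : R -> R) (n : nat) (x l : R) :
  is_derive_n f n x l -> ex_derive_n f n x.
Proof. destruct n; intros H; [exact I | exists l; exact H]. Qed.

(** The admissible constants are exactly the upper bounds of the difference quotients, so the
    supremum of these is the smallest one; [a < b] provides at least one quotient. *)
Lemma is_lipschitz_constant_exists (f : R -> R) (a b L : R) : a < b ->
  lipschitz_on f a b L ->
  exists L0, is_lipschitz_constant f a b L0 /\ L0 <= L.
Proof.
  intros ab HL.
  set (E q := exists x y, a <= x <= b /\ a <= y <= b /\ x <> y /\
    q = Rabs (f x - f y) / Rabs (x - y)).
  assert (upper : forall L', lipschitz_on f a b L' <-> is_upper_bound E L').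
  { intros L'. split.
    - intros H q (x & y & hx & hy & hxy & ->).
      apply Rle_div_l; [apply Rlt_gt, Rabs_pos_lt; lra | apply H; assumption].
    - intros H x y hx hy. destruct (Req_dec x y) as [<-|hxy].
      + rewrite !Rminus_diag, Rabs_R0. lra.
      + apply Rle_div_l; [apply Rlt_gt, Rabs_pos_lt; lra|].
        apply H. exists x, y. auto. }
  destruct (completeness E) as [L0 [H1 H2]].
  - exists L. apply upper, HL.
  - exists (Rabs (f a - f b) / Rabs (a - b)), a, b. repeat split; lra.
  - exists L0. split; [split|].
    + apply upper, H1.
    + intros L' H. apply H2, upper, H.
    + apply H2, upper, HL.
Qed.

Lemma periodic_IZR (f : R -> R) (T : R) : (forall x, f (x + T) = f x) ->
  forall (k : Z) (x : R), f (x + IZR k * T) = f x.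
Proof.
  intros Hf k. induction k as [|k IH|k IH] using Z.peano_ind; intros x.
  - f_equal. ring.
  - rewrite succ_IZR, <- (IH x), <- (Hf (x + IZR k * T)). f_equal. ring.
  - rewrite <- Z.sub_1_r, minus_IZR, <- (IH x), <- (Hf (x + (IZR k - 1) * T)).
    f_equal. ring.
Qed.

(** * Smoothness and Lipschitz bound of the periodization *)

Section Periodization.

Variables (s : nat) (psi w psi_w : R -> R).
Hypotheses (hdpsi : forall k x, (k <= s + 1)%nat -> ex_derive_n psi k x)
  (hdw : forall k x, (k <= s + 1)%nat -> ex_derive_n w k x)
  (hzw : forall x, ~ (- PI < x < PI) -> w x = 0)
  (hpsi_w : is_windowed_periodization w psi psi_w).

Let g y := w y * psi y.

Lemma windowed_ex_derive_n (k : nat) (x : R) : (k <= s + 1)%nat -> ex_derive_n g k x.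
Proof.
  intros hk. eapply is_derive_n_ex, is_derive_n_mult;
    intros; [apply hdw | apply hdpsi]; lia.
Qed.

(** Continuity of the derivative of order [k] comes from the existence of the next one, hence
    [k <= s]. *)
Lemma windowed_derivative_outside (k : nat) (x : R) :
  (k <= s)%nat -> ~ (- PI < x < PI) -> Derive_n g k x = 0.
Proof.
  intros hk hx. apply (Derive_n_zero_outside g (- PI) PI); [| | exact hx].
  - intros t ht. unfold g. rewrite hzw by exact ht. ring.
  - apply (ex_derive_continuous (Derive_n g k)), (windowed_ex_derive_n (S k)). lia.
Qed.

(** The two translates live on adjacent open intervals, so at most one summand is nonzero; at the
    seam [PI] both vanish, matching the prescribed [psi_w PI = 0]. *)
Lemma periodization_two_windows (x : R) : - PI < x < 3 * PI ->
  psi_w x = g x + g (x + - (2 * PI)).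
Proof.
  destruct hpsi_w as (per & inside & at_PI). intros hx. unfold g.
  destruct (Rtotal_order x PI) as [h|[->|h]].
  - rewrite inside, (hzw (x + _)) by lra. ring.
  - rewrite at_PI, !hzw by lra. ring.
  - rewrite (hzw x) by lra. rewrite <- inside by lra.
    rewrite <- (per (x + _)). rewrite Rmult_0_l, Rplus_0_l. f_equal. ring.
Qed.

Lemma locally_two_windows (x : R) : - PI < x < 3 * PI ->
  locally x (fun t => g t + g (t + - (2 * PI)) = psi_w t).
Proof.
  intros hx. apply (locally_interval _ x (- PI) (3 * PI)); simpl; try apply hx.
  intros t h1 h2. symmetry. apply periodization_two_windows. split; assumption.
Qed.

Lemma ex_derive_n_shift (k : nat) (x : R) : (k <= s + 1)%nat ->
  ex_derive_n (fun t => g (t + - (2 * PI))) k x.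
Proof. intros hk. apply ex_derive_n_comp_trans, windowed_ex_derive_n, hk. Qed.

Lemma periodization_ex_derive_n (k : nat) (x : R) :
  (k <= s)%nat -> ex_derive_n psi_w k x.
Proof.
  intros hk. pose proof PI_RGT_0 as P0.
  assert (near : forall y, - PI < y < 3 * PI -> ex_derive_n psi_w k y).
  { intros y hy. apply (ex_derive_n_ext_loc _ _ _ _ (locally_two_windows y hy)).
    apply ex_derive_n_plus; apply filter_forall; intros.
    - apply windowed_ex_derive_n. lia.
    - apply ex_derive_n_shift. lia. }
  (* Removing [m] periods moves [x] into [[0, 2 PI)], which lies inside [(-PI, 3 PI)]. *)
  set (m := Int_part (x / (2 * PI))).
  apply (ex_derive_n_ext (fun t => psi_w (t + IZR (- m) * (2 * PI)))).
  { intros t. apply periodic_IZR, hpsi_w. }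
  apply ex_derive_n_comp_trans, near.
  destruct (base_Int_part (x / (2 * PI))) as [h1 h2]. fold m in h1, h2.
  rewrite opp_IZR.
  assert (E : x = x / (2 * PI) * (2 * PI)) by (field; lra).
  set (q := x / (2 * PI)) in *. rewrite E. split; nra.
Qed.

Lemma periodization_Derive_n (x : R) : - PI <= x <= PI ->
  Derive_n psi_w s x = Derive_n g s x.
Proof.
  pose proof PI_RGT_0 as P0.
  assert (right : forall y, - PI < y <= PI -> Derive_n psi_w s y = Derive_n g s y).
  { intros y hy.
    rewrite <- (Derive_n_ext_loc _ _ s y (locally_two_windows y ltac:(lra))).
    rewrite Derive_n_plus.
    - rewrite Derive_n_comp_trans, (windowed_derivative_outside s (y + _))
        by (lia || lra).
      apply Rplus_0_r.
    - apply filter_forall; intros; apply windowed_ex_derive_n; lia.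
    - apply filter_forall; intros; apply ex_derive_n_shift; lia. }
  intros [[h|<-] h2]; [apply right; lra|].
  (* The point [-PI] is outside the range of the two-window formula; periodicity moves it to [PI],
     and [g] has zero derivative of order [s] at both points. *)
  rewrite <- (Derive_n_ext _ _ s (- PI) (proj1 hpsi_w)).
  rewrite Derive_n_comp_trans.
  replace (- PI + 2 * PI) with PI by ring. rewrite right by lra.
  rewrite !windowed_derivative_outside by (lia || lra). reflexivity.
Qed.

(** On [[-PI, PI]] the derivative of order [s] is that of [g], which is differentiable everywhere,
    so the mean value inequality applies up to both endpoints. *)
Lemma periodization_lipschitz (L : R) :
  (forall x, Rabs (Derive_n g (s + 1) x) <= L) ->
  lipschitz_on (Derive_n psi_w s) (- PI) PI L.
Proof.
  intros HL x y hx hy. rewrite !periodization_Derive_n by assumption.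
  apply (bounded_variation (Derive_n g s) (Derive_n g (s + 1))).
  intros t _. split; [|apply HL].
  rewrite Nat.add_1_r. apply is_derive_Derive_n, windowed_ex_derive_n. lia.
Qed.

End Periodization.

Theorem theorem4p6 (rho : R) (s : nat) (psi w psi_w : R -> R)
  (M_psi M_psi_s1 : R)
  (hrho : 0 <= rho < PI)
  (hs : (1 <= s)%nat)
  (hpsi : Ck (s + 1) psi)
  (hw : is_bump (s + 1) rho w)
  (hM : 0 <= M_psi)
  (hM1 : 0 <= M_psi_s1)
  (hbound : forall x, - PI < x < PI ->
     Rabs (psi x) <= M_psi /\ Rabs (Derive_n psi (s + 1) x) <= M_psi_s1)
  (hpsi_w : is_windowed_periodization w psi psi_w) :
  (forall n x, (n <= s)%nat -> ex_derive_n psi_w n x) /\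
  exists L_s : R,
    is_lipschitz_constant (Derive_n psi_w s) (- PI) PI L_s /\
    L_s <= M_psi_s1 + M_psi * sup_norm (Derive_n w (s + 1))
           + C_const s M_psi M_psi_s1
             * C_const s 1 (sup_norm (Derive_n w (s + 1)))
             / (2 * PI) ^ (s + 1) * K_const s.
Proof.
  pose proof (proj1 hpsi) as hdpsi. pose proof (proj1 (proj1 hw)) as hdw.
  assert (hzw : forall x, ~ (- PI < x < PI) -> w x = 0) by apply hw.
  pose proof PI_RGT_0.
  split.
  (* As [Derive_n] is total, this part certifies that [Derive_n psi_w s] is a genuine derivative. *)
  - intros n x. apply (periodization_ex_derive_n s psi w); assumption.
  - apply is_lipschitz_constant_exists; [lra|].
    apply (periodization_lipschitz s psi w); try assumption.
    intros x. apply (windowed_derivative_bound rho); assumption.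
Qed.
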